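(* Let $m,n\in\mathbb{N}$. Define $$I_{m,n}:=\{(a,b,t)\in \mathbb{N}^2\times \mathbb{N}_0:\ a\mid m,\ b\mid n,\ 0\le t\le \gcd(a,n/b)-1\}$$ and for $(a,b,t)\in I_{m,n}$ define $$H_{a,b,t}:=\left\{\left(ia+\frac{jta}{\gcd(a,n/b)},\ jb\right):\ 0\le i\le \frac{m}{a}-1,\ 0\le j\le \frac{n}{b}-1\right\}\subseteq \mathbb{Z}_m\times\mathbb{Z}_n,$$ where $i,j$ are integers and the first and second coordinates are read modulo $m$ and modulo $n$, respectively. Then for every $(a,b,t)\in I_{m,n}$ the set $H_{a,b,t}$ is a subgroup of $\mathbb{Z}_m\times\mathbb{Z}_n$ of order $\frac{mn}{ab}$, and the map $(a,b,t)\mapsto H_{a,b,t}$ is a bijection between the set $I_{m,n}$ and the set of subgroups of $\mathbb{Z}_m\times\mathbb{Z}_n$.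
   Context: $\mathbb{N}=\{1,2,\ldots\}$, $\mathbb{N}_0=\{0,1,2,\ldots\}$. $\mathbb{Z}_m$ denotes the additive group of residue classes modulo $m$. *)

(* Defs.v *)
From HB Require Import structures.
From mathcomp Require Import all_boot all_order all_algebra all_fingroup.

Set Implicit Arguments.
Unset Strict Implicit.
Unset Printing Implicit Defensive.

(* For 0 < m, the type 'I_m.-1.+1 is 'I_m with addition modulo m as its group
   law. The library's 'Z_m is not used because 'Z_1 is the group of order 2.
   The group law of Zpair is the componentwise one, written multiplicatively. *)
Definition Zpair (m n : nat) : finGroupType := ('I_m.-1.+1 * 'I_n.-1.+1)%type.

Definition index_set (m n : nat) : pred (nat * nat * nat) :=
  fun x => let: (a, b, t) := x in
  [&& 0 < a, 0 < b, a %| m, b %| n & t < gcdn a (n %/ b)].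

(* All the divisions are exact when index_set m n (a, b, t) holds. *)
Definition Hset (m n : nat) (x : nat * nat * nat) : {set Zpair m n} :=
  let: (a, b, t) := x in
  [set ((inZp (i * a + (j * t * a) %/ gcdn a (n %/ b)), inZp (j * b))
         : Zpair m n)
     | i : 'I_(m %/ a), j : 'I_(n %/ b)].

(* Main.v *)
Require Import Defs.
From HB Require Import structures.
From mathcomp Require Import all_boot all_order all_algebra all_fingroup.

Set Implicit Arguments.
Unset Strict Implicit.
Unset Printing Implicit Defensive.

(** Write g for gcd(a, n/b) and s for t * a / g. The numbers s obtained for
    0 <= t < g are exactly the residues s < a such that a divides s * (n/b),
    which says that (n/b) * (s, b) = ((n/b) * s, 0) is a multiple of (a, 0).

    The whole argument rests on a membership criterion (mem_Hset): the class of
    (x, y) lies in H_{a,b,t} iff b divides y and x = (y/b) * s modulo a. These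
    conditions are additive and contain the identity, so H_{a,b,t} is a
    subgroup; the parametrisation by (i, j) is injective, which gives its order.
    The triple is recovered from the subgroup: the elements (x, 0) of H_{a,b,t}
    are those with a | x, the second coordinates that occur are the multiples
    of b, and s is the residue modulo a of the first coordinates occurring
    above b.

    Conversely, given a subgroup G, let a be the least positive integer with
    (a, 0) in G, let b be the least positive second coordinate of an element of
    G, and let (s, b) in G with s < a. Division with remainder shows that a and
    b divide the corresponding coordinates, in particular m and n. Since
    (n/b) * (s, b) = ((n/b) * s, 0), a divides (n/b) * s, so s has the form
    t * a / g, and G satisfies the membership criterion of H_{a,b,t}. *)

(** * Classes of pairs of natural numbers *)

(** The class in Z_m x Z_n of a pair of natural numbers. *)
Definition pairZ (m n x y : nat) : Zpair m n := (inZp x, inZp y).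

Lemma pairZ_val m n (z : Zpair m n) : pairZ m n z.1 z.2 = z.
Proof. by case: z => z1 z2; rewrite /pairZ /= !valZpK. Qed.

Lemma pairZM m n x y x' y' :
  (pairZ m n x y * pairZ m n x' y')%g = pairZ m n (x + x') (y + y').
Proof. by congr pair; apply: val_inj; rewrite /= modnDm. Qed.

Lemma pairZ1 m n : pairZ m n 0 0 = 1%g.
Proof. by congr pair; apply: val_inj; rewrite /= mod0n. Qed.

Lemma eq_pairZ m n x y x' y' : 0 < m -> 0 < n ->
  (pairZ m n x y == pairZ m n x' y') =
  (x == x' %[mod m]) && (y == y' %[mod n]).
Proof.
by move=> m0 n0; rewrite /pairZ xpair_eqE -!val_eqE /= !prednK.
Qed.

Lemma pairZ_inj m n x y x' y' : 0 < m -> 0 < n ->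
  x = x' %[mod m] -> y = y' %[mod n] -> pairZ m n x y = pairZ m n x' y'.
Proof. by move=> m0 n0 ex ey; apply/eqP; rewrite eq_pairZ // ex ey !eqxx. Qed.

(** * The first coordinate of the generator above b *)

(** The first coordinate t * a / gcd(a, n/b) of the generator of H_{a,b,t} whose
    second coordinate is b. *)
Definition shift (n a b t : nat) : nat := t * (a %/ gcdn a (n %/ b)).

Lemma shift_ltn n a b t : 0 < a -> t < gcdn a (n %/ b) -> shift n a b t < a.
Proof.
move=> a0 tg; rewrite -[ltnRHS](divnK (dvdn_gcdl a (n %/ b))) /shift mulnC.
rewrite ltn_pmul2l //.
by rewrite divn_gt0 ?gcdn_gt0 ?a0 // dvdn_leq ?dvdn_gcdl.
Qed.

Lemma dvdn_shift n a b t : a %| n %/ b * shift n a b t.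
Proof.
rewrite /shift; set g := gcdn _ _.
rewrite -{1}(divnK (dvdn_gcdr a (n %/ b))) -/g.
by rewrite mulnACA (mulnC g) divnK ?dvdn_gcdl ?dvdn_mull.
Qed.

(** Since a / g and (n/b) / g are coprime, the divisibility hypothesis forces
    a / g to divide s. *)
Lemma dvdn_shiftP n a b s : 0 < a -> s < a -> a %| n %/ b * s ->
  exists2 t, t < gcdn a (n %/ b) & shift n a b t = s.
Proof.
move=> a0 sa; set g := gcdn a (n %/ b) => a_dvd.
have g0 : 0 < g by rewrite gcdn_gt0 a0.
have c_dvd : a %/ g %| s.
  have co : coprime (a %/ g) (n %/ b %/ g).
    rewrite /coprime -(eqn_pmul2r g0) mul1n muln_gcdl.
    by rewrite !divnK ?dvdn_gcdl ?dvdn_gcdr.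
  rewrite -(Gauss_dvdr _ co) -(dvdn_pmul2r g0) divnK ?dvdn_gcdl //.
  by rewrite mulnAC divnK ?dvdn_gcdr.
exists (s %/ (a %/ g)); last by rewrite /shift divnK.
have c0 : 0 < a %/ g by rewrite divn_gt0 // dvdn_leq ?dvdn_gcdl.
by rewrite ltn_divLR // mulnC divnK ?dvdn_gcdl.
Qed.

(** * The subgroups H_{a,b,t} *)

Section Hset.

Variables (m n a b t : nat).
Hypotheses (m_gt0 : 0 < m) (n_gt0 : 0 < n) (abt : index_set m n (a, b, t)).

Let s := shift n a b t.

Lemma index_setP :
  [/\ 0 < a, 0 < b, a %| m, b %| n & t < gcdn a (n %/ b)].
Proof. exact/and5P. Qed.

Lemma HsetE : Hset m n (a, b, t) =
  [set pairZ m n (ij.1 * a + ij.2 * s) (ij.2 * b)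
     | ij : 'I_(m %/ a) * 'I_(n %/ b) in setX setT setT].
Proof.
have eZ i j : pairZ m n (i * a + j * s) (j * b) =
    pairZ m n (i * a + (j * t * a) %/ gcdn a (n %/ b)) (j * b).
  by rewrite /s /shift mulnA muln_divA ?dvdn_gcdl.
apply/setP=> z; apply/imset2P/imsetP => [[i j _ _ ->]|[[i j] _ ->]].
  by exists (i, j); rewrite ?inE ?eZ.
by exists i j; rewrite ?inE ?eZ.
Qed.

Lemma card_Hset : #|Hset m n (a, b, t)| = (m * n) %/ (a * b).
Proof.
have [a0 b0 am bn _] := index_setP.
rewrite HsetE card_in_imset; last first.
  move=> [i j] [i' j'] _ _ /eqP; rewrite eq_pairZ //= => /andP[ei ej].
  have lt_b (k : 'I_(n %/ b)) : k * b < n by rewrite -ltn_divRL.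
  have lt_a (k : 'I_(m %/ a)) : k * a < m by rewrite -ltn_divRL.
  move: ej; rewrite !modn_small // eqn_pmul2r // => /eqP/val_inj ej.
  move: ei; rewrite ej eqn_modDr !modn_small // eqn_pmul2r // => /eqP/val_inj.
  by move=> ->.
rewrite cardsX !cardsT !card_ord.
rewrite -{2}(divnK am) -{2}(divnK bn) mulnACA mulnK ?muln_gt0 ?a0 //.
Qed.

(** Membership criterion: no bound is imposed on x and y, and the right-hand
    side is invariant modulo m and modulo n because a divides m and
    (n/b) * s. *)
Lemma mem_Hset x y : (pairZ m n x y \in Hset m n (a, b, t)) =
  (b %| y) && (x == y %/ b * s %[mod a]).
Proof.
have [a0 b0 am bn _] := index_setP.
have a_ns : n %/ b * s = 0 %[mod a].
  by rewrite mod0n; apply/eqP; apply: dvdn_shift.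
have modn_div z : z %/ b * s = (z %% n) %/ b * s %[mod a].
  rewrite {1}(divn_eq z n) divnDl ?dvdn_mull // -muln_divA // mulnDl.
  by rewrite -mulnA -modnDml -modnMmr a_ns mod0n muln0 mod0n.
rewrite HsetE; apply/imsetP/andP => [[[i j] _ /eqP]|[b_y /eqP ex]].
  rewrite eq_pairZ //= => /andP[/eqP ex /eqP ey].
  have b_y : b %| y.
    by rewrite (divn_eq y n) ey dvdn_add ?dvdn_mull // /dvdn modn_dvdm ?modnMl.
  split=> //; apply/eqP.
  rewrite -(modn_dvdm x am) ex modn_dvdm // modnMDl.
  by rewrite (modn_div y) ey -modn_div mulnK.
pose j := y %/ b %% (n %/ b).
have lt_j : j < n %/ b by rewrite ltn_mod divn_gt0 // dvdn_leq.
have ej : j * b = y %% n by rewrite muln_modl !divnK.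
have {}ex : x = j * s %[mod a] by rewrite ex (modn_div y) -ej mulnK.
(* Adding the multiple m * (j * s) of m keeps the subtraction exact in nat. *)
pose d := x + m * (j * s) - j * s.
have le_d : j * s <= x + m * (j * s).
  by apply: leq_trans (leq_addl _ _); rewrite leq_pmull.
have a_d : a %| d.
  rewrite /d -eqn_mod_dvd // -modnDmr -modnMml.
  by rewrite (eqP am) mul0n mod0n addn0 ex.
have lt_i : d %/ a %% (m %/ a) < m %/ a.
  by rewrite ltn_mod divn_gt0 // dvdn_leq.
exists (Ordinal lt_i, Ordinal lt_j); first by rewrite !inE.
apply: pairZ_inj => //=; last by rewrite ej modn_mod.
by rewrite muln_modl !divnK // modnDml subnK // addnC mulnC modnMDl.
Qed.

Lemma group_set_Hset : group_set (Hset m n (a, b, t)).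
Proof.
have [a0 b0 am bn _] := index_setP.
apply/group_setP; split; first by rewrite -pairZ1 mem_Hset dvdn0 div0n mul0n /=.
move=> u v; rewrite -(pairZ_val u) -(pairZ_val v) pairZM !mem_Hset.
move=> /andP[bu /eqP eu] /andP[bv /eqP ev].
by rewrite dvdn_add //= divnDl // mulnDl -modnDm eu ev modnDm.
Qed.

End Hset.

(** The three conclusions express that the generators (a, 0) and (s, b) of
    H_{a,b,t}, where s = shift n a b t, belong to H_{a',b',t'}. *)
Lemma Hset_sub m n a b t a' b' t' : 0 < m -> 0 < n ->
  index_set m n (a, b, t) -> index_set m n (a', b', t') ->
  Hset m n (a, b, t) = Hset m n (a', b', t') ->
  [/\ a' %| a, b' %| b &
      shift n a b t = b %/ b' * shift n a' b' t' %[mod a']].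
Proof.
move=> m0 n0 I I' eH; have [_ b0 _ _ _] := index_setP I.
have : pairZ m n a 0 \in Hset m n (a, b, t).
  by rewrite mem_Hset // dvdn0 div0n mul0n /= modnn mod0n.
rewrite eH mem_Hset // dvdn0 div0n mul0n mod0n => /= a'a.
have : pairZ m n (shift n a b t) b \in Hset m n (a, b, t).
  by rewrite mem_Hset // dvdnn divnn b0 mul1n /=.
by rewrite eH mem_Hset // => /andP[b'b /eqP].
Qed.

Lemma Hset_inj m n x x' : 0 < m -> 0 < n ->
  index_set m n x -> index_set m n x' -> Hset m n x = Hset m n x' -> x = x'.
Proof.
case: x x' => [[a b] t] [[a' b'] t'] m0 n0 I I' eH.
have [a'a b'b es] := Hset_sub m0 n0 I I' eH.
have [aa' bb' _] := Hset_sub m0 n0 I' I (esym eH).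
have {aa' a'a} ea : a' = a by apply/eqP; rewrite eqn_dvd a'a.
have {bb' b'b} eb : b' = b by apply/eqP; rewrite eqn_dvd b'b.
subst a' b'.
have [a0 b0 _ _ tg] := index_setP I; have [_ _ _ _ tg'] := index_setP I'.
move: es; rewrite divnn b0 mul1n !modn_small ?shift_ltn // => /eqP.
rewrite /shift eqn_pmul2r => [/eqP -> //|].
by rewrite divn_gt0 ?gcdn_gt0 ?a0 // dvdn_leq ?dvdn_gcdl.
Qed.

(** * Every subgroup is some H_{a,b,t} *)

Section Subgroup.

Variables (m n : nat) (G : {group Zpair m n}).
Hypotheses (m_gt0 : 0 < m) (n_gt0 : 0 < n).

(** Membership in G of the class of (x, y); inGB below subtracts a member
    without using subtraction of natural numbers. *)
Let inG x y := pairZ m n x y \in G.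

Let inGD x y x' y' : inG x y -> inG x' y' -> inG (x + x') (y + y').
Proof. by rewrite /inG -pairZM; apply: groupM. Qed.

Let inGB x y x' y' : inG (x + x') (y + y') -> inG x' y' -> inG x y.
Proof. by rewrite /inG -pairZM => + Gx'; rewrite groupMr. Qed.

Let inG0 : inG 0 0.
Proof. by rewrite /inG pairZ1 group1. Qed.

Let inGM k x y : inG x y -> inG (k * x) (k * y).
Proof. by move=> Gxy; elim: k => // k IHk; rewrite !mulSn inGD. Qed.

Let inGm : inG m 0.
Proof.
by rewrite /inG (@pairZ_inj m n m 0 0 0) ?modnn ?mod0n //; apply: inG0.
Qed.

Let inGn : inG 0 n.
Proof.
by rewrite /inG (@pairZ_inj m n 0 n 0 0) ?modnn ?mod0n //; apply: inG0.
Qed.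

Lemma group_Hset : exists2 x, index_set m n x & G = Hset m n x :> {set _}.
Proof.
have exa : exists a, (0 < a) && inG a 0 by exists m; rewrite m_gt0 inGm.
have exb : exists b, (0 < b) && [exists x : 'I_m, inG x b].
  exists n; rewrite n_gt0; apply/existsP; exists (Ordinal m_gt0).
  exact: inGn.
case: (ex_minnP exa) => a /andP[a0 Ga] min_a.
case: (ex_minnP exb) => b /andP[b0 /existsP[s0 Gs0]] min_b.
have a_dvd x : inG x 0 -> a %| x.
  rewrite {1}(divn_eq x a) addnC => Gx.
  have Gr : inG (x %% a) 0.
    by apply: (@inGB _ _ (x %/ a * a) 0) => //; rewrite -(muln0 (x %/ a)) inGM.
  rewrite /dvdn; case: posnP => // r0.
  by have := min_a (x %% a); rewrite r0 Gr leqNgt ltn_mod a0 => /(_ isT).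
have inG_mod x y : inG (x %% m) y = inG x y.
  by rewrite /inG (@pairZ_inj m n (x %% m) y x y) // modn_mod.
have b_dvd x y : inG x y -> b %| y.
  move=> Gxy; rewrite /dvdn; case: posnP => // r0.
  have Gq := inGM (y %/ b) Gs0.
  set q := y %/ b * s0 in Gq.
  (* Subtract Gq; the multiple m * q of m keeps the first coordinate in nat. *)
  have Gr : inG (x + m * q - q) (y %% b).
    apply: (@inGB _ _ q (y %/ b * b)) => //.
    rewrite subnK; last by apply: leq_trans (leq_addl _ _); rewrite leq_pmull.
    rewrite [y %% b + _]addnC -divn_eq -[y]addn0 inGD // mulnC.
    by rewrite -(muln0 q) inGM.
  have := min_b (y %% b); rewrite r0 leqNgt ltn_mod b0 /= => -> //.
  apply/existsP; exists (Ordinal (ltn_pmod (x + m * q - q) m_gt0)).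
  by rewrite inG_mod.
have am : a %| m by apply: a_dvd.
have bn : b %| n by apply: b_dvd inGn.
(* The first coordinates occurring above a given y form one class modulo a. *)
have inG_eq x x' y : inG x' y -> inG x y = (x == x' %[mod a]).
  wlog: x x' / x' <= x => [IH|le_x] Gx'.
    case: (leqP x' x) => [|/ltnW] le_x; first exact: IH.
    apply/idP/idP => [Gx|ex]; first by rewrite eq_sym -(IH x' x).
    move: ex; rewrite eq_sym eqn_mod_dvd // => /dvdnP[k ek].
    apply: (@inGB _ _ (x' - x) 0); first by rewrite subnKC // addn0.
    by rewrite ek -(muln0 k) inGM.
  rewrite eqn_mod_dvd //; apply/idP/idP => [Gx|/dvdnP[k ek]].
    by apply/a_dvd/(@inGB _ _ x' y); rewrite ?subnK.
  by rewrite -(subnK le_x) -[y]add0n inGD // ek -(muln0 k) inGM.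
have sa : s0 %% a < a by rewrite ltn_mod.
have Gs : inG (s0 %% a) b by rewrite (inG_eq _ s0) // modn_mod.
have a_ns : a %| n %/ b * (s0 %% a).
  apply: a_dvd; apply: (@inGB _ _ 0 n); rewrite // addn0 add0n.
  by rewrite -[X in inG _ X](divnK bn) inGM.
have [t tg es] := dvdn_shiftP a0 sa a_ns.
have I : index_set m n (a, b, t) by apply/and5P.
exists (a, b, t) => //; apply/setP=> z; rewrite -(pairZ_val z) mem_Hset //.
rewrite es -/(inG z.1 z.2); case: (boolP (b %| z.2)) => [bz|] /=; last first.
  by move=> nbz; apply/negbTE; apply: contra nbz; apply: b_dvd.
by apply: inG_eq; rewrite -{2}(divnK bz) inGM.
Qed.

End Subgroup.

Theorem theorem1 (m n : nat) (hm : 0 < m) (hn : 0 < n) :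
  (forall a b t : nat, index_set m n (a, b, t) ->
     group_set (Hset m n (a, b, t)) /\
     #|Hset m n (a, b, t)| = (m * n) %/ (a * b)) /\
  (exists f : {x : nat * nat * nat | index_set m n x} -> {group Zpair m n},
     (forall x, f x = Hset m n (val x) :> {set Zpair m n}) /\ bijective f).
Proof.
split=> [a b t abt|]; first by split; [apply: group_set_Hset|apply: card_Hset].
have gP (x : {x | index_set m n x}) : group_set (Hset m n (val x)).
  by case: x => [[[a b] t] abt]; apply: group_set_Hset.
pose f x := Group (gP x).
have f_inj : injective f.
  move=> x x' /(congr1 val) /= eH; apply: val_inj.
  exact: Hset_inj hm hn (valP x) (valP x') eH.
have f_surj G : exists x, f x == G.
  have [x Ix eG] := group_Hset G hm hn.
  by exists (exist _ x Ix); apply/eqP/val_inj; rewrite /= -eG.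
exists f; split=> //; exists (fun G => xchoose (f_surj G)) => [x|G].
  by apply: f_inj; apply/eqP/(xchooseP (f_surj (f x))).
exact/eqP/(xchooseP (f_surj G)).
Qed.
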